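(* Let $D\in\mathcal E^n$ have embedding dimension $r$. Let $\bar k_1,\bar k_2,\bar k_3$ be nonnegative integers and define $$\alpha_1:=1\!:\!(\bar k_1+\bar k_2),\quad \alpha_2:=(\bar k_1+1)\!:\!(\bar k_1+\bar k_2+\bar k_3)\subseteq 1\!:\!n,$$ $$k_1:=|\alpha_1|=\bar k_1+\bar k_2,\quad k_2:=|\alpha_2|=\bar k_2+\bar k_3,\quad k:=\bar k_1+\bar k_2+\bar k_3,$$ where $k_1,k_2\ge1$. For $i=1,2$, let $\bar D_i:=D[\alpha_i]\in\mathcal E^{k_i}$ have embedding dimension $t_i$, let $B_i:=\mathcal K^\dagger(\bar D_i)=\bar U_iS_i\bar U_i^T$, where $\bar U_i\in\mathcal M^{k_i\times t_i}$, $\bar U_i^T\bar U_i=I_{t_i}$, $S_i\in\mathcal S^{t_i}_{++}$, and let $U_i:=\begin{bmatrix}\bar U_i&\frac1{\sqrt{k_i}}e\end{bmatrix}\in\mathcal M^{k_i\times(t_i+1)}$. Let $t$ and $\bar U\in\mathcal M^{k\times(t+1)}$ satisfy $$\mathcal R(\bar U)=\mathcal R\left(\begin{bmatrix}U_1&0\\0&I_{\bar k_3}\end{bmatrix}\right)\cap\mathcal R\left(\begin{bmatrix}I_{\bar k_1}&0\\0&U_2\end{bmatrix}\right),\qquad \bar U^T\bar U=I_{t+1}.$$ Let $U:=\begin{bmatrix}\bar U&0\\0&I_{n-k}\end{bmatrix}\in\mathcal M^{n\times(n-k+t+1)}$ and let $\begin{bmatrix}V&\frac{U^Te}{\|U^Te\|}\end{bmatrix}\in\mathcal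 M^{n-k+t+1}$ be orthogonal. Then $$\bigcap_{i=1}^2\operatorname{face}\,\mathcal K^\dagger\left(\mathcal E^n(\alpha_i,\bar D_i)\right)=\left(U\,\mathcal S_+^{n-k+t+1}\,U^T\right)\cap\mathcal S_C=(UV)\,\mathcal S_+^{n-k+t}\,(UV)^T.$$
   Context: Notation. $\mathcal S^n$ is the space of real symmetric $n\times n$ matrices; $\mathcal S^n_+$, $\mathcal S^n_{++}$ are the positive semidefinite and positive definite matrices in $\mathcal S^n$. $\mathcal M^{p\times q}$ is the space of real $p\times q$ matrices and $\mathcal M^p=\mathcal M^{p\times p}$. $\mathcal R(\cdot)$ denotes range (column space). $e$ is the all-ones vector of appropriate dimension, and $a\!:\!b=\{a,a+1,\dots,b\}$. For $\alpha\subseteq 1\!:\!n$, $Y[\alpha]$ is the principal submatrix of $Y$ with rows and columns indexed by $\alpha$. Euclidean distance matrices. $D\in\mathcal S^n$ is a Euclidean distance matrix (EDM) if there are an integer $r\ge0$ and points $p_1,\dots,p_n\in\mathbb R^r$ with $D_{ij}=\|p_i-p_j\|_2^2$ for all $i,j$ (squared distances); the smallest such $r$ is the embedding dimension of $D$. $\mathcal E^n\subset\mathcal S^n$ is the cone of $n\times n$ EDMs. For $\alpha\subseteq1\!:\!n$ with $|\alpha|=k$ and $\bar D\in\mathcal E^k$, $\mathcal E^n(\alpha,\bar D):=\{D\in\mathcal E^n: D[\alpha]=\bar D\}$. Operators. $\mathcal K:\mathcal S^n\to\mathcal S^n$ is $\mathcal K(Y)=\operatorname{diag}(Y)e^T+e\operatorname{diag}(Y)^T-2Y$,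 where $\operatorname{diag}(Y)$ is the vector of diagonal entries of $Y$. Its Moore–Penrose generalized inverse is $\mathcal K^\dagger(D)=-\frac12J\,\mathrm{offDiag}(D)\,J$, where $J=I-\frac1nee^T$ and $\mathrm{offDiag}(D)$ is $D$ with its diagonal replaced by zeros. The same symbols are used for matrices of any order (with $n$ replaced by the order). $\mathcal S_C=\{Y\in\mathcal S^n:Ye=0\}$. Faces. For a convex cone $K$, $F\subseteq K$ is a face of $K$ if $x,y\in K$ and $\frac12(x+y)\in F$ imply that the convex cone generated by $\{x,y\}$ is contained in $F$. For $S\subseteq\mathcal S^n_+$, $\operatorname{face}(S)$ is the smallest face of $\mathcal S^n_+$ containing $S$. $U\mathcal S^m_+U^T:=\{UZU^T: Z\in\mathcal S^m_+\}$. *)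

(* Defs.v *)
From mathcomp Require Import all_boot all_order all_algebra.
From mathcomp Require Import classical_sets reals.

Set Implicit Arguments.
Unset Strict Implicit.
Unset Printing Implicit Defensive.
Import Order.TTheory GRing.Theory Num.Theory.
Local Open Scope classical_set_scope.
Local Open Scope ring_scope.

Section Matrices.
Context {R : realType}.

Definition Sym n : set 'M[R]_n := [set Y | Y^T = Y].

Definition Psd n : set 'M[R]_n :=
  [set Y | Sym Y /\ forall x : 'cV[R]_n, 0 <= (x^T *m Y *m x) 0 0].

Definition Pd n : set 'M[R]_n :=
  [set Y | Sym Y /\ forall x : 'cV[R]_n, x != 0 -> 0 < (x^T *m Y *m x) 0 0].

Definition ones n : 'cV[R]_n := const_mx 1.

Definition sqnorm n (x : 'cV[R]_n) : R := \sum_(i < n) x i 0 ^+ 2.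
Definition norm2 n (x : 'cV[R]_n) : R := Num.sqrt (sqnorm x).

Definition col_range p q (A : 'M[R]_(p, q)) : set 'cV[R]_p :=
  range (fun x : 'cV[R]_q => A *m x).

(* Stated for two a priori different dimensions, so that a matrix that is
   square only up to an identity between dimensions needs no cast. *)
Definition orthogonal_mx p q (W : 'M[R]_(p, q)) :=
  W^T *m W = 1%:M /\ W *m W^T = 1%:M.

(* D[alpha]; [enum_val] lists the elements of alpha in increasing order. *)
Definition principal_sub n (alpha : {set 'I_n}) (D : 'M[R]_n) : 'M[R]_#|alpha| :=
  mxsub enum_val enum_val D.

Definition edm_realizable n (D : 'M[R]_n) (r : nat) :=
  exists p : 'I_n -> 'cV[R]_r, forall i j, D i j = sqnorm (p i - p j).

Definition EDM n : set 'M[R]_n := [set D | exists r, edm_realizable D r].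

Definition has_embedding_dim n (D : 'M[R]_n) (r : nat) :=
  edm_realizable D r /\ forall s, edm_realizable D s -> (r <= s)%N.

Definition EDM_completions n (alpha : {set 'I_n}) (Dbar : 'M[R]_#|alpha|) :
  set 'M[R]_n := [set D | EDM D /\ principal_sub alpha D = Dbar].

Definition off_diag n (D : 'M[R]_n) : 'M[R]_n :=
  \matrix_(i, j) (if i == j then 0 else D i j).

Definition centering n : 'M[R]_n := 1%:M - n%:R^-1 *: (ones n *m (ones n)^T).

(* Closed form of the Moore-Penrose inverse of
   K(Y) = diag(Y) e^T + e diag(Y)^T - 2 Y on the symmetric matrices. *)
Definition Kdag n (D : 'M[R]_n) : 'M[R]_n :=
  - 2^-1 *: (centering n *m off_diag D *m centering n).

Definition SC n : set 'M[R]_n := [set Y | Sym Y /\ Y *m ones n = 0].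

Definition cone2 n (x y : 'M[R]_n) : set 'M[R]_n :=
  [set z | exists a b : R, [/\ 0 <= a, 0 <= b & z = a *: x + b *: y]].

Definition is_face n (K F : set 'M[R]_n) :=
  F `<=` K /\
  forall x y, K x -> K y -> F (2^-1 *: (x + y)) -> cone2 x y `<=` F.

Definition face n (S : set 'M[R]_n) : set 'M[R]_n := smallest (is_face (@Psd n)) S.

Definition psd_congr p q (U : 'M[R]_(p, q)) : set 'M[R]_p :=
  [set U *m Z *m U^T | Z in @Psd q].

Definition append_ones p q (Ubar : 'M[R]_(p, q)) : 'M[R]_(p, q + 1) :=
  row_mx Ubar ((Num.sqrt p%:R)^-1 *: ones p).

End Matrices.

(* The index interval (a+1):b of 1:n; ordinals start at 0. *)
Definition idx_range n (a b : nat) : {set 'I_n} :=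
  [set i : 'I_n | (a <= i < b)%N]%SET.

Lemma card_idx_range n a b :
  (a <= b)%N -> (b <= n)%N -> #|idx_range n a b| = (b - a)%N.
Proof.
move=> ab bn; rewrite -sum1_card.
rewrite (eq_bigl (fun i : 'I_n => (a <= i)%N && (i < b)%N)) => [|i]; last first.
  by rewrite inE.
rewrite -(big_mkord (fun i => (a <= i)%N && (i < b)%N) (fun=> 1%N)).
by rewrite -big_nat_widen // -(big_nat_widenl a 0 b xpredT) // sum_nat_const_nat muln1.
Qed.

Lemma overlap_left n k1 k2 k3 : (k1 + k2 + k3 <= n)%N ->
  (#|idx_range n 0 (k1 + k2)| + k3 = k1 + k2 + k3)%N.
Proof.
by move=> h; rewrite card_idx_range ?subn0 // (leq_trans (leq_addr _ _) h).
Qed.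

Lemma overlap_right n k1 k2 k3 : (k1 + k2 + k3 <= n)%N ->
  (k1 + #|idx_range n k1 (k1 + k2 + k3)| = k1 + k2 + k3)%N.
Proof.
by move=> h; rewrite card_idx_range -?addnA ?leq_addr ?addKn // !addnA.
Qed.

(* Main.v *)
Require Import Defs.
From mathcomp Require Import all_boot all_order all_algebra.
From mathcomp Require Import classical_sets reals.
From mathcomp Require Import ring lra zify.

(** The three sets are described by which vectors the range of a positive
    semidefinite matrix [Y] may contain, and then compared.

    A set [psd_congr G] consists of the positive semidefinite matrices whose
    range lies in the range of [G] ([psd_congr_range]).  It is a face, and any
    face containing [G *m G^T] contains all of it: for [Y] in [psd_congr G] some
    multiple [c *: (G *m G^T)] dominates [Y], so that [G *m G^T] is a positive
    multiple of the midpoint of [Y] and another positive semidefinite matrix.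
    Hence the face generated by a subset of [psd_congr G] which contains
    [G *m G^T] is [psd_congr G] itself ([face_psd_congr]).

    For one clique [alpha], if [D] is the distance matrix of the rows of [P],
    then [Kdag D] is the Gram matrix of the centered rows.  Every completion
    restricts on [alpha] to a configuration with the prescribed distances, so
    the range of its image under [Kdag] consists of vectors orthogonal to
    [ones] whose restriction to [alpha] is in the range of [append_ones Ubar].
    All such vectors occur in the range for the completion that is as spread
    out as possible: the points indexed by [alpha] stay in place and each other
    point is moved along a new coordinate axis of its own.  Its image under
    [Kdag] is the required [G *m G^T], and [face_clique] follows.

    The two faces thus intersect in the positive semidefinite [Y] with
    [Y *m ones n = 0] whose range satisfies both restriction conditions.  The
    hypothesis on [Ubar] says precisely that the two conditions together define
    the range of [U].  Finally the range of [U *m V] is the part of the range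
    of [U] that is orthogonal to [ones] ([psd_congr_ortho_compl]). *)

Set Implicit Arguments.
Unset Strict Implicit.
Unset Printing Implicit Defensive.
Import Order.TTheory GRing.Theory Num.Theory.
Local Open Scope classical_set_scope.
Local Open Scope ring_scope.

(** * Positive semidefinite matrices and the faces of their cone *)

Section Psd.
Context {R : realType}.

Lemma sqnormE n (x : 'cV[R]_n) : sqnorm x = (x^T *m x) 0 0.
Proof. by rewrite /sqnorm mxE; apply: eq_bigr => i _; rewrite mxE expr2. Qed.

Lemma sqnorm_ge0 n (x : 'cV[R]_n) : 0 <= sqnorm x.
Proof. by apply: sumr_ge0 => i _; apply: sqr_ge0. Qed.

Lemma sqnorm_eq0 n (x : 'cV[R]_n) : sqnorm x = 0 -> x = 0.
Proof.
move=> x0; apply/colP => i; rewrite mxE; apply/eqP; rewrite -sqrf_eq0.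
move/eqP: x0; rewrite psumr_eq0 => [|j _]; rewrite ?sqr_ge0 //.
by move/allP/(_ i (mem_index_enum i)).
Qed.

Lemma Psd_congr p q (U : 'M[R]_(p, q)) Z : Psd Z -> Psd (U *m Z *m U^T).
Proof.
move=> [sZ Z0]; split=> [|x].
  by rewrite /Sym /= !trmx_mul trmxK sZ mulmxA.
by have := Z0 (U^T *m x); rewrite trmx_mul trmxK !mulmxA.
Qed.

Lemma Pd1 n : Pd (1%:M : 'M[R]_n).
Proof.
split=> [|x x0]; first exact: trmx1.
rewrite mulmx1 -sqnormE lt_neqAle sqnorm_ge0 andbT.
by apply: contra x0 => /eqP/esym/sqnorm_eq0->.
Qed.

Lemma Pd_Psd n (Y : 'M[R]_n) : Pd Y -> Psd Y.
Proof.
move=> [sY Y0]; split=> // x; have [->|/Y0/ltW//] := eqVneq x 0.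
by rewrite mulmx0 mxE.
Qed.

Lemma Psd_gram p q (A : 'M[R]_(p, q)) : Psd (A *m A^T).
Proof. by rewrite -[A in A *m _]mulmx1; apply/Psd_congr/Pd_Psd/Pd1. Qed.

(** Where a nonnegative form vanishes it is minimal, so its gradient vanishes
    too.  Concretely, moving from [x] along [Y *m x] would otherwise make the
    form negative. *)
Lemma Psd_ker n (Y : 'M[R]_n) (x : 'cV[R]_n) :
  Psd Y -> (x^T *m Y *m x) 0 0 = 0 -> Y *m x = 0.
Proof.
move=> [sY Y0] x0; apply: sqnorm_eq0; set w := Y *m x.
pose a := (w^T *m Y *m w) 0 0; pose b := sqnorm w.
have b0 : 0 <= b by apply: sqnorm_ge0.
have a0 : 0 <= a by apply: Y0.
have quad s : 0 <= 2 * s * b + s ^+ 2 * a.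
  have := Y0 (x + s *: w).
  have -> : (x + s *: w)^T *m Y *m (x + s *: w) =
      x^T *m Y *m x + s *: (w^T *m w) + s *: (w^T *m w) + s ^+ 2 *: (w^T *m Y *m w).
    have ew : x^T *m Y = w^T by rewrite trmx_mul sY.
    rewrite [(x + _)^T]linearD /= [(s *: w)^T]linearZ /=.
    rewrite !mulmxDl !mulmxDr -!scalemxAl -!scalemxAr.
    by rewrite ew -!mulmxA -/w expr2 scalerA addrA.
  have entry (A B C : 'M[R]_1) : (A + s *: B + s *: B + s ^+ 2 *: C) 0 0 =
      A 0 0 + 2 * s * B 0 0 + s ^+ 2 * C 0 0 by rewrite !mxE; ring.
  by rewrite entry x0 add0r -sqnormE.
apply/eqP; rewrite eq_le -/b b0 andbT leNgt; apply/negP => b1.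
(* The step would be - b / a at the minimum; the shift avoids a = 0. *)
have := quad (- b / (a + 1)).
have a1 : 0 < a + 1 by lra.
rewrite leNgt => /negP; apply.
have -> : 2 * (- b / (a + 1)) * b + (- b / (a + 1)) ^+ 2 * a =
  - ((b / (a + 1)) ^+ 2 * (a + 2)).
  field; lra.
by rewrite oppr_lt0 mulr_gt0 ?exprn_gt0 ?divr_gt0 //; lra.
Qed.

Lemma col_rangeP p q (A : 'M[R]_(p, q)) x :
  col_range A x <-> exists z, x = A *m z.
Proof. by split=> [[z _ <-]|[z ->]]; exists z. Qed.

(** Row spaces are annihilators of kernels; this turns an inclusion of ranges
    into a condition on the vectors that are killed, which for a semidefinite
    matrix are those where its form vanishes. *)
Lemma submx_ker m p q (A : 'M[R]_(m, p)) (B : 'M[R]_(q, p)) :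
  (forall v : 'cV[R]_p, B *m v = 0 -> A *m v = 0) <-> (A <= B)%MS.
Proof.
split=> [AB|/submxP[C ->] v Bv]; last by rewrite -mulmxA Bv mulmx0.
rewrite submxE; apply/eqP/matrixP => i j; rewrite [RHS]mxE.
have := AB (cokermx B *m delta_mx j 0).
rewrite [B *m _]mulmxA mulmx_coker mul0mx [A *m _]mulmxA -colE.
move=> /(_ erefl)/colP/(_ i).
by rewrite mxE => ->; rewrite mxE.
Qed.

Lemma submx_range m p q (A : 'M[R]_(p, m)) (B : 'M[R]_(p, q)) :
  (forall x, col_range B (A *m x)) <-> (A^T <= B^T)%MS.
Proof.
split=> [AB|/submxP[C]].
  apply/row_subP => i; have /col_rangeP[z Az] := AB (delta_mx i 0).
  by rewrite -tr_col colE Az trmx_mul submxMl.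
move=> /(congr1 trmx); rewrite trmx_mul !trmxK => -> x.
by apply/col_rangeP; exists (C^T *m x); rewrite mulmxA.
Qed.

(** When the row space of the symmetric matrix [Y] lies in that of [G^T], so
    does its column space in that of [G]; factoring through a pseudo-inverse
    [N] on both sides exhibits [Y] as [G *m (N^T *m Y *m N) *m G^T]. *)
Lemma psd_congr_submx p q (G : 'M[R]_(p, q)) Y :
  psd_congr G Y <-> Psd Y /\ (Y <= G^T)%MS.
Proof.
split=> [[Z hZ <-]|[hY YG]]; first by split; [apply: Psd_congr | apply: submxMl].
have [N YN] : exists N, Y *m N *m G^T = Y by exists (pinvmx G^T); apply: mulmxKpV.
exists (N^T *m Y *m N).
  by have := Psd_congr N^T hY; rewrite trmxK.
have NY : G *m N^T *m Y = Y.
  by have [sY _] := hY; rewrite -{2}sY -{2}YN !trmx_mul trmxK sY mulmxA.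
by rewrite !mulmxA NY YN.
Qed.

Lemma psd_congr_ker p q (G : 'M[R]_(p, q)) Y :
  psd_congr G Y <-> Psd Y /\ forall v : 'cV_p, G^T *m v = 0 -> Y *m v = 0.
Proof. by rewrite psd_congr_submx submx_ker. Qed.

Lemma psd_congr_range p q (G : 'M[R]_(p, q)) Y :
  psd_congr G Y <-> Psd Y /\ forall x, col_range G (Y *m x).
Proof.
rewrite psd_congr_submx submx_range.
by split=> -[[sY Y0]]; rewrite sY.
Qed.

(** A sum of two nonnegative forms vanishes at [v] only if both do, and then
    both matrices kill [v] by [Psd_ker]; so the kernel condition passes from a
    midpoint to its two ends. *)
Lemma psd_congr_face p q (G : 'M[R]_(p, q)) : is_face (@Psd R p) (psd_congr G).
Proof.
split=> [Y /psd_congr_ker[]//|x y hx hy /psd_congr_ker[_ hxy]].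
have ker (v : 'cV_p) : G^T *m v = 0 -> x *m v = 0 /\ y *m v = 0.
  move=> /hxy h; have : (v^T *m (2^-1 *: (x + y)) *m v) 0 0 = 0.
    by rewrite -mulmxA h mulmx0 mxE.
  rewrite -scalemxAr -scalemxAl mulmxDr mulmxDl 2!mxE => {}h.
  have [[_ /(_ v) x0] [_ /(_ v) y0]] := (hx, hy).
  by split; apply: Psd_ker => //; lra.
move=> z [a [b [a0 b0 ->]]]; apply/psd_congr_ker; split=> [|v /ker[xv yv]].
  have [[sx x0] [sy y0]] := (hx, hy); split=> [|v].
    by rewrite /Sym /= linearD !linearZ /= sx sy.
  have entry (A B : 'M[R]_1) : (a *: A + b *: B) 0 0 = a * A 0 0 + b * B 0 0.
    by rewrite !mxE.
  rewrite mulmxDr mulmxDl -!scalemxAr -!scalemxAl entry.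
  by rewrite addr_ge0 // mulr_ge0.
by rewrite mulmxDl -!scalemxAl xv yv !scaler0 addr0.
Qed.

(** The sum of the absolute values of the entries of [H] is a crude bound which
    avoids eigenvalues; 1 is added so that one may divide by [c]. *)
Lemma qform_le q (H : 'M[R]_q) :
  exists2 c : R, 0 < c & forall y, (y^T *m H *m y) 0 0 <= c * sqnorm y.
Proof.
exists (1 + \sum_i \sum_j `|H i j|) => [|y].
  by rewrite ltr_pwDl // sumr_ge0 // => i _; rewrite sumr_ge0.
have yi i : y i 0 ^+ 2 <= sqnorm y.
  by rewrite /sqnorm (bigD1 i) //= lerDl sumr_ge0 // => j _; apply: sqr_ge0.
rewrite mulrDl mul1r; apply: ler_wpDl; first exact: sqnorm_ge0.
rewrite mxE exchange_big /= mulr_suml; apply: ler_sum => j _.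
rewrite mxE !mulr_suml; apply: ler_sum => i _; rewrite mxE.
apply: le_trans (ler_norm _) _; rewrite !normrM mulrAC mulrC ler_wpM2l //.
have [h1 h2] := (yi i, yi j); rewrite -normrM ler_norml.
by apply/andP; split; nra.
Qed.

(** The matrix [G *m G^T] is in the relative interior of [psd_congr G]: a
    multiple of it dominates any given [Y] there, so it is a midpoint of a
    multiple of [Y] and a semidefinite matrix, and the face property of [F]
    puts [Y] in [F]. *)
Lemma psd_congr_sub_face p q (G : 'M[R]_(p, q)) (F : set 'M[R]_p) :
  is_face (@Psd R p) F -> F (G *m G^T) -> psd_congr G `<=` F.
Proof.
move=> [_ hF] FG _ [H hH <-]; have [c c0 hc] := qform_le H.
have cn : c != 0 by rewrite gt_eqF.
set Y := G *m H *m G^T; set Y0 := G *m G^T.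
have hY : Psd Y by apply: Psd_congr.
have hX : Psd (c *: Y0 - Y).
  have [[sY _] [sY0 _]] := (hY, Psd_gram G).
  split=> [|x]; first by rewrite /Sym /= linearB linearZ /= sY sY0.
  have entry (A B : 'M[R]_1) : (c *: A - B) 0 0 = c * A 0 0 - B 0 0.
    by rewrite !mxE.
  rewrite mulmxBr mulmxBl -scalemxAr -scalemxAl entry subr_ge0.
  have := hc (G^T *m x); rewrite sqnormE trmx_mul trmxK /Y /Y0 !mulmxA.
  by rewrite mulrC [_ * c]mulrC.
have pos s (X : 'M[R]_p) : 0 <= s -> Psd X -> Psd (s *: X).
  move=> s0 [sX X0]; split=> [|x]; first by rewrite /Sym /= linearZ /= sX.
  by rewrite -scalemxAr -scalemxAl mxE mulr_ge0.
have s0 : 0 <= 2 / c by rewrite divr_ge0 // ltW.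
apply: (hF ((2 / c) *: Y) ((2 / c) *: (c *: Y0 - Y))); [exact: pos|exact: pos| |].
  rewrite -scalerDr addrC subrK !scalerA.
  by have -> : 2^-1 * (2 / c * c) = 1; [field | rewrite scale1r].
exists (c / 2), 0; split; rewrite ?divr_ge0 ?(ltW c0) //.
rewrite scale0r addr0 scalerA.
by have -> : c / 2 * (2 / c) = 1; [field | rewrite scale1r].
Qed.

Lemma face_psd_congr p q (G : 'M[R]_(p, q)) (S : set 'M[R]_p) :
  S (G *m G^T) -> S `<=` psd_congr G -> face S = psd_congr G.
Proof.
move=> SG SS; apply/seteqP; split.
  by apply: smallest_sub => //; apply: psd_congr_face.
move=> Y hY F [hF SF]; exact: (psd_congr_sub_face hF (SF _ SG)).
Qed.

Lemma col_range_congr p q (A : 'M[R]_(p, q)) S :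
  Pd S -> col_range (A *m S *m A^T) = col_range A.
Proof.
move=> hS; apply/seteqP; split=> x /col_rangeP[z ->].
  by apply/col_rangeP; exists (S *m A^T *m z); rewrite !mulmxA.
move: z; apply/submx_range/submx_ker => v.
have [sS S0] := hS; rewrite !trmx_mul trmxK sS -!mulmxA => Av.
have [//|/S0] := eqVneq (A^T *m v) 0.
by rewrite trmx_mul trmxK -!mulmxA Av mulmx0 mxE ltxx.
Qed.

(** The kernel of a symmetric matrix is the orthogonal complement of its
    range. *)
Lemma sym_ker n (Y : 'M[R]_n) (v : 'cV[R]_n) : Sym Y ->
  Y *m v = 0 <-> forall x : 'cV_n, v^T *m (Y *m x) = 0.
Proof.
move=> sY; split=> [Yv x|vY].
  by rewrite mulmxA -sY -trmx_mul Yv trmx0 mul0mx.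
rewrite -sY -[v]trmxK -trmx_mul; apply/colP => i.
by have /matrixP/(_ 0 0) := vY (delta_mx i 0); rewrite mulmxA -colE !mxE.
Qed.

(** Since the columns of [V] complete the unit vector along [U^T *m v] to an
    orthonormal basis, [U *m z] is orthogonal to [v] exactly when [z] is in the
    range of [V].  The normalizing factor is nonzero because the last column
    has norm 1. *)
Lemma psd_congr_ortho_compl p q m (U : 'M[R]_(p, q)) (V : 'M[R]_(q, m)) v Y :
  orthogonal_mx (row_mx V ((norm2 (U^T *m v))^-1 *: (U^T *m v))) ->
  psd_congr U Y /\ Y *m v = 0 <-> psd_congr (U *m V) Y.
Proof.
set w := _ *: _ => -[].
rewrite tr_row_mx mul_col_row scalar_mx_block => /eq_block_mx[_ _ wV ww].
rewrite mul_row_col => VV.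
have vV : (U^T *m v)^T *m V = 0.
  have [/eqP c0|c0] := eqVneq ((norm2 (U^T *m v))^-1) 0.
    move: ww; rewrite /w (eqP c0) scale0r mulmx0 => /matrixP/(_ 0 0)/eqP.
    by rewrite !mxE eq_sym oner_eq0.
  move: wV; rewrite linearZ /= -scalemxAl => /eqP.
  by rewrite scaler_eq0 (negPf c0) => /eqP.
rewrite !psd_congr_range; split=> [[[hY YU] Yv]|[hY YUV]].
  split=> // x; have /col_rangeP[z Yx] := YU x.
  have wz : w^T *m z = 0.
    have /(_ x) := proj1 (sym_ker v (proj1 hY)) Yv.
    rewrite Yx /w linearZ /= trmx_mul trmxK -scalemxAl -mulmxA => ->.
    exact: scaler0.
  apply/col_rangeP; exists (V^T *m z); rewrite Yx -!mulmxA [V *m _]mulmxA.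
  rewrite -[V *m V^T](addrK (w *m w^T)) VV mulmxBl mul1mx.
  by rewrite -mulmxA wz mulmx0 subr0.
split; first split=> // x.
  have /col_rangeP[z ->] := YUV x.
  by apply/col_rangeP; exists (V *m z); rewrite mulmxA.
apply/(sym_ker v (proj1 hY)) => x; have /col_rangeP[z ->] := YUV x.
by move: vV; rewrite trmx_mul trmxK !mulmxA => ->; rewrite mul0mx.
Qed.

End Psd.

(** * Distance matrices and the face of one clique *)

Section Edm.
Context {R : realType}.

Definition edm_of n r (P : 'M[R]_(n, r)) : 'M[R]_n :=
  \matrix_(i, j) sqnorm (row i P - row j P)^T.

Lemma edm_realizableP n r (D : 'M[R]_n) :
  edm_realizable D r <-> exists P : 'M[R]_(n, r), D = edm_of P.
Proof.
split=> [[p Dp]|[P ->]]; last first.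
  by exists (fun i => (row i P)^T) => i j; rewrite mxE linearB.
exists (\matrix_(i, j) p i j 0); apply/matrixP => i j; rewrite mxE Dp.
by congr sqnorm; apply/colP => l; rewrite !mxE.
Qed.

Lemma edm_ofE n r (P : 'M[R]_(n, r)) i j :
  edm_of P i j = (P *m P^T) i i + (P *m P^T) j j - 2 * (P *m P^T) i j.
Proof.
rewrite mxE /sqnorm !mxE mulr_sumr -sumrN -!big_split /=.
by apply: eq_bigr => l _; rewrite !mxE; ring.
Qed.

Lemma edm_of_gram n r s (P : 'M[R]_(n, r)) (Q : 'M[R]_(n, s)) :
  P *m P^T = Q *m Q^T -> edm_of P = edm_of Q.
Proof. by move=> PQ; apply/matrixP => i j; rewrite !edm_ofE PQ. Qed.

Lemma principal_sub_edm_of n r (alpha : {set 'I_n}) (P : 'M[R]_(n, r)) :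
  principal_sub alpha (edm_of P) = edm_of (rowsub enum_val P).
Proof.
apply/matrixP => i j; rewrite !mxE; congr sqnorm.
by apply/colP => l; rewrite !mxE.
Qed.

Lemma tr_centering n : (centering n)^T = centering n :> 'M[R]_n.
Proof. by rewrite /centering linearB linearZ /= trmx1 trmx_mul trmxK. Qed.

Lemma centering_mul n m (X : 'M[R]_(n, m)) :
  centering n *m X = X - n%:R^-1 *: (ones n *m ((ones n)^T *m X)).
Proof. by rewrite /centering mulmxBl mul1mx -scalemxAl mulmxA. Qed.

Lemma centering_col n (x : 'cV[R]_n) :
  exists c, centering n *m x = x - c *: ones n.
Proof.
rewrite centering_mul; exists (n%:R^-1 * ((ones n)^T *m x) 0 0).
rewrite -scalerA; congr (_ - _ *: _).
by rewrite [X in _ *m X]mx11_scalar mul_mx_scalar.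
Qed.

Lemma centering_ones n : (0 < n)%N -> centering n *m ones n = 0 :> 'cV[R]_n.
Proof.
move=> n0; rewrite centering_mul.
have -> : (ones n)^T *m ones n = n%:R%:M :> 'M[R]_1.
  rewrite [LHS]mx11_scalar mxE; congr _%:M.
  rewrite (eq_bigr (fun=> 1)) => [|i _]; last by rewrite !mxE mulr1.
  by rewrite sumr_const card_ord.
by rewrite mul_mx_scalar scalerA mulVf ?scale1r ?subrr // pnatr_eq0 -lt0n.
Qed.

Lemma ones_centering n : (0 < n)%N -> (ones n)^T *m centering n = 0 :> 'rV[R]_n.
Proof.
by move=> n0; rewrite -[LHS]trmxK trmx_mul trmxK tr_centering centering_ones ?trmx0.
Qed.

(** The distance matrix is [d *m e^T + e *m d^T] minus twice the Gram matrix,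
    where [d] holds the squared norms and [e] is [ones n]; centering kills the
    first two terms. *)
Lemma Kdag_edm_of n r (P : 'M[R]_(n, r)) : (0 < n)%N ->
  Kdag (edm_of P) = (centering n *m P) *m (centering n *m P)^T.
Proof.
move=> n0; pose d : 'cV[R]_n := \col_i (P *m P^T) i i.
have D0 : off_diag (edm_of P) = d *m (ones n)^T + ones n *m d^T - 2 *: (P *m P^T).
  apply/matrixP => i j; rewrite mxE.
  have -> : (d *m (ones n)^T + ones n *m d^T - 2 *: (P *m P^T)) i j = edm_of P i j.
    rewrite edm_ofE [X in X = _]mxE [X in X + _]mxE; congr (_ + _ + _).
    - by rewrite mxE big_ord1 [X in X * _]mxE !mxE mulr1.
    - by rewrite mxE big_ord1 [X in X * _]mxE [X in _ * X]mxE mul1r mxE.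
    - by rewrite !mxE.
  case: eqP => // ->; rewrite edm_ofE; ring.
rewrite /Kdag D0; move: (tr_centering n) (centering_ones n0) (ones_centering n0).
(* The centering matrix is itself a difference, which rewriting with the
   distributivity lemmas must not see. *)
move: (centering n) => J tJ Je eJ.
have J1 : J *m (d *m (ones n)^T) *m J = 0 by rewrite -!mulmxA eJ !mulmx0.
have J2 : J *m (ones n *m d^T) *m J = 0 by rewrite !mulmxA Je !mul0mx.
rewrite mulmxBr mulmxBl mulmxDr mulmxDl J1 J2 addr0 sub0r.
rewrite -scalemxAr -scalemxAl scalerN scaleNr opprK.
by rewrite scalerA mulVf ?pnatr_eq0 // scale1r trmx_mul tJ !mulmxA.
Qed.

Lemma append_ones_range p q (U : 'M[R]_(p, q)) x : (0 < p)%N ->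
  col_range (append_ones U) x <-> exists z c, x = U *m z + c *: ones p.
Proof.
move=> p0; have s0 : Num.sqrt p%:R != 0 :> R by rewrite sqrtr_eq0 -ltNge ltr0n.
split=> [/col_rangeP[y ->]|[z [c ->]]].
  exists (usubmx y), ((Num.sqrt p%:R)^-1 * dsubmx y 0 0).
  rewrite -{1}[y]vsubmxK mul_row_col; congr (_ + _).
  by rewrite [dsubmx y]mx11_scalar mul_mx_scalar scalerA !mxE mulr1n mulrC.
apply/col_rangeP; exists (col_mx z (Num.sqrt p%:R * c)%:M).
by rewrite mul_row_col mul_mx_scalar scalerA mulrAC divff // mul1r.
Qed.

(** The columns of [U] span the range of the centered configuration, because a
    Gram matrix has the same range as its factor.  Adding [ones p] undoes the
    centering, so the range of [append_ones U] depends only on the distances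
    and can be computed from any realization [P] of them. *)
Lemma clique_range p q r (P : 'M[R]_(p, r)) (U : 'M[R]_(p, q)) S x :
  (0 < p)%N -> Pd S -> Kdag (edm_of P) = U *m S *m U^T ->
  col_range (append_ones U) x <-> exists z c, x = P *m z + c *: ones p.
Proof.
move=> p0 hS; rewrite Kdag_edm_of // append_ones_range //.
move=> /(congr1 (@col_range R p p)); rewrite col_range_congr //.
rewrite -[X in col_range (X *m _)]mulmx1 (col_range_congr _ (Pd1 _)) => PU.
split=> -[z [c ->]].
  have : col_range U (U *m z) by apply/col_rangeP; exists z.
  rewrite -PU => /col_rangeP[y ->]; rewrite -mulmxA.
  have [c' ->] := centering_col (P *m y).
  by exists y, (c - c'); rewrite scalerBl addrA addrAC.
have : col_range U (centering p *m P *m z) by rewrite -PU; apply/col_rangeP; exists z.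
move=> /col_rangeP[y]; rewrite -mulmxA; have [c' ->] := centering_col (P *m z).
by move=> e; exists y, (c + c'); rewrite -e scalerDl addrA addrAC subrK.
Qed.

Lemma rowsub_ones n p (f : 'I_p -> 'I_n) : rowsub f (ones n) = ones p :> 'cV[R]_p.
Proof. by apply/colP => i; rewrite !mxE. Qed.

(** The face generated by all completions is [psd_congr G], where [G] is the
    centered configuration in which every point outside [alpha] has a coordinate
    of its own.  A vector with a prescribed restriction to [alpha] can be
    matched elsewhere by these coordinates, so only orthogonality to [ones n]
    and the condition of [clique_range] constrain the range of [G]. *)
Lemma face_clique n q (alpha : {set 'I_n}) (D : 'M[R]_n)
    (U : 'M[R]_(#|alpha|, q)) S Y :
  EDM D -> (0 < #|alpha|)%N -> Pd S ->
  Kdag (principal_sub alpha D) = U *m S *m U^T ->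
  face (@Kdag R n @` EDM_completions (principal_sub alpha D)) Y <->
  [/\ Psd Y, Y *m ones n = 0 &
      forall x : 'cV_n, col_range (append_ones U) (rowsub enum_val (Y *m x))].
Proof.
move=> [r /edm_realizableP[P ->]] a0 hS; rewrite principal_sub_edm_of => hB.
have n0 : (0 < n)%N.
  by apply: leq_trans a0 _; rewrite -[X in (_ <= X)%N]card_ord max_card.
(* Any configuration with the prescribed distances on the clique serves as the
   realization in clique_range. *)
have inU s (Q : 'M[R]_(n, s)) z :
    edm_of (rowsub (@enum_val _ (mem alpha)) Q) = edm_of (rowsub enum_val P) ->
    col_range (append_ones U) (rowsub enum_val (centering n *m Q *m z)).
  move=> QP; rewrite -QP in hB; apply/(clique_range _ a0 hS hB).
  rewrite -mulmxA; have [c ->] := centering_col (Q *m z).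
  exists z, (- c); rewrite mul_rowsub_mx -(rowsub_ones enum_val).
  by apply/colP => i; rewrite !mxE mulNr.
(* Each point outside the clique is displaced by a unit vector along a
   coordinate of its own; points of the clique get zero new coordinates. *)
pose mask : 'rV[R]_n := \row_i (i \notin alpha)%:R.
pose Q := row_mx P (diag_mx mask); pose G := centering n *m Q.
have Qa : edm_of (rowsub (@enum_val _ (mem alpha)) Q) = edm_of (rowsub enum_val P).
  have -> : rowsub (@enum_val _ (mem alpha)) Q =
      row_mx (rowsub enum_val P) (0 : 'M_(_, n)).
    apply/matrixP => i j; rewrite !mxE; case: split => l; rewrite !mxE //.
    by rewrite enum_valP mul0rn.
  by apply: edm_of_gram; rewrite tr_row_mx mul_row_col trmx0 mulmx0 addr0.
have GP x : col_range G x <->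
    (ones n)^T *m x = 0 /\ col_range (append_ones U) (rowsub enum_val x).
  split=> [/col_rangeP[z ->]|[x0]].
    by split; [rewrite !mulmxA ones_centering ?mul0mx | apply: inU].
  move/(clique_range _ a0 hS hB) => [z [c xz]].
  (* The part of x not explained by the original points lives outside the
     clique, where the new coordinates produce any vector. *)
  pose y := x - P *m z - c *: ones n.
  have yM : diag_mx mask *m y = y.
    apply/colP => i; rewrite mul_diag_mx mxE [mask _ _]mxE.
    case: (boolP (i \in alpha)) => [ia|_]; last by rewrite mul1r.
    have /colP/(_ (enum_rank_in ia i)) := xz.
    rewrite mul_rowsub_mx -(rowsub_ones enum_val) !mxE enum_rankK_in // => ->.
    by rewrite mul0r addrAC addrK subrr.
  apply/col_rangeP; exists (col_mx z y); rewrite -mulmxA mul_row_col yM.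
  have -> : P *m z + y = x - c *: ones n by rewrite /y addrA addrCA subrr addr0.
  rewrite mulmxBr -scalemxAr centering_ones // scaler0 subr0.
  by rewrite centering_mul x0 mulmx0 scaler0 subr0.
rewrite (@face_psd_congr _ _ _ G) => [||Y' [D' [[s /edm_realizableP[Q' ->]]]]];
  last 2 first.
- exists (edm_of Q); last by rewrite Kdag_edm_of.
  split; last by rewrite principal_sub_edm_of.
  by exists (r + n)%N; apply/edm_realizableP; exists Q.
- rewrite principal_sub_edm_of => Q'a <-; rewrite Kdag_edm_of //.
  apply/psd_congr_range; split=> [|x]; first exact: Psd_gram.
  rewrite -mulmxA; apply/GP; split; last exact: inU.
  by rewrite !mulmxA ones_centering ?mul0mx.
rewrite psd_congr_range; split=> [[hY YG]|[hY Y1 YU]]; have [sY _] := hY.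
  by split=> //; [apply/(sym_ker (ones n) sY) => x|move=> x]; have /GP[] := YG x.
split=> // x; apply/GP; split=> //.
by move/(sym_ker (ones n) sY): Y1.
Qed.

End Edm.

(** * Index intervals and block ranges *)

(** The enumeration of the interval and [iota a (b - a)] are strictly increasing
    lists with the same members, hence equal. *)
Lemma enum_val_idx_range n a b (i : 'I_#|idx_range n a b|) :
  (b <= n)%N -> val (enum_val i) = (a + i)%N.
Proof.
move=> bn.
have E : [seq val j | j <- enum (idx_range n a b)] = iota a (b - a).
  apply: (irr_sorted_eq ltn_trans ltnn).
  - rewrite (_ : map val _ = [seq j <- iota 0 n | (a <= j < b)%N]).
      by apply: (sorted_filter ltn_trans); apply: iota_ltn_sorted.
    rewrite -val_enum_ord filter_map; congr map.
    by rewrite {1}/enum_mem -enumT; apply: eq_filter => j; rewrite /= inE.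
  - exact: iota_ltn_sorted.
  move=> j; rewrite mem_iota; apply/mapP/idP => [[l]|jab].
    rewrite mem_enum inE => lab -> /=; lia.
  have jn : (j < n)%N by lia.
  exists (Ordinal jn) => //; rewrite mem_enum inE /=; lia.
have sz : size (enum (idx_range n a b)) = (b - a)%N.
  by rewrite -(size_map val) E size_iota.
have ib : (i < b - a)%N by rewrite -sz -cardE.
rewrite (enum_val_nth (enum_default i)) -(nth_map _ 0%N val) ?sz // E.
by rewrite nth_iota.
Qed.

Section Blocks.
Context {R : realType}.

Lemma col_range_diag_l a b m p (e : (a + b)%N = m) (A : 'M[R]_(a, p)) x :
  col_range (castmx (e, erefl) (block_mx A 0 0 1%:M)) x <->
  col_range A (rowsub (cast_ord e \o lshift b) x).
Proof.
case: m / e x => x; rewrite castmx_id.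
have -> : rowsub (cast_ord erefl \o lshift b) x = usubmx x.
  by apply/colP => i; rewrite !mxE /= cast_ord_id.
split=> /col_rangeP[z xz]; apply/col_rangeP.
  exists (usubmx z); rewrite xz -{1}[z]vsubmxK mul_block_col col_mxKu.
  by rewrite mul0mx addr0.
exists (col_mx z (dsubmx x)); rewrite mul_block_col !mul0mx mul1mx addr0 add0r.
by rewrite -xz vsubmxK.
Qed.

Lemma col_range_diag_r a b m p (e : (a + b)%N = m) (A : 'M[R]_(b, p)) x :
  col_range (castmx (e, erefl) (block_mx 1%:M 0 0 A)) x <->
  col_range A (rowsub (cast_ord e \o @rshift a b) x).
Proof.
case: m / e x => x; rewrite castmx_id.
have -> : rowsub (cast_ord erefl \o @rshift a b) x = dsubmx x.
  by apply/colP => i; rewrite !mxE /= cast_ord_id.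
split=> /col_rangeP[z xz]; apply/col_rangeP.
  exists (dsubmx z); rewrite xz -{1}[z]vsubmxK mul_block_col col_mxKd.
  by rewrite mul0mx add0r.
exists (col_mx (usubmx x) z); rewrite mul_block_col !mul0mx mul1mx addr0 add0r.
by rewrite -xz vsubmxK.
Qed.

End Blocks.

(** * Intersecting the faces of two overlapping cliques *)

Unset Implicit Arguments.
Theorem theorem2p7 (R : realType) (n r : nat) (D : 'M[R]_n)
  (hD : EDM D) (hr : has_embedding_dim D r)
  (kb1 kb2 kb3 : nat)
  (k := (kb1 + kb2 + kb3)%N) (hk : (k <= n)%N)
  (alpha1 := idx_range n 0 (kb1 + kb2))
  (alpha2 := idx_range n kb1 (kb1 + kb2 + kb3))
  (hk1 : (1 <= #|alpha1|)%N) (hk2 : (1 <= #|alpha2|)%N)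
  (Dbar1 := principal_sub alpha1 D) (Dbar2 := principal_sub alpha2 D)
  (t1 t2 : nat)
  (ht1 : has_embedding_dim Dbar1 t1) (ht2 : has_embedding_dim Dbar2 t2)
  (Ubar1 : 'M[R]_(#|alpha1|, t1)) (S1 : 'M[R]_t1)
  (hB1 : Kdag Dbar1 = Ubar1 *m S1 *m Ubar1^T)
  (hUbar1 : Ubar1^T *m Ubar1 = 1%:M) (hS1 : Pd S1)
  (Ubar2 : 'M[R]_(#|alpha2|, t2)) (S2 : 'M[R]_t2)
  (hB2 : Kdag Dbar2 = Ubar2 *m S2 *m Ubar2^T)
  (hUbar2 : Ubar2^T *m Ubar2 = 1%:M) (hS2 : Pd S2)
  (U1 := append_ones Ubar1) (U2 := append_ones Ubar2)
  (t : nat) (Ubar : 'M[R]_(k, t + 1))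
  (hrange : col_range Ubar =
     col_range (castmx (overlap_left hk, erefl)
                  (block_mx U1 0 0 (1%:M : 'M[R]_kb3)))
     `&` col_range (castmx (overlap_right hk, erefl)
                  (block_mx (1%:M : 'M[R]_kb1) 0 0 U2)))
  (hUbar : Ubar^T *m Ubar = 1%:M)
  (U := castmx (subnKC hk, erefl)
          (block_mx Ubar 0 0 (1%:M : 'M[R]_(n - k)))
     : 'M[R]_(n, t + 1 + (n - k)))
  (V : 'M[R]_(t + 1 + (n - k), t + (n - k)))
  (hV : orthogonal_mx
     (row_mx V ((norm2 (U^T *m ones n))^-1 *: (U^T *m ones n)))) :
  face ((@Kdag R n) @` EDM_completions Dbar1)
    `&` face ((@Kdag R n) @` EDM_completions Dbar2)
    = psd_congr U `&` @SC R n
  /\ psd_congr U `&` @SC R n = psd_congr (U *m V).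
Proof.
have rangeU x : col_range U x <->
    col_range U1 (rowsub enum_val x) /\ col_range U2 (rowsub enum_val x).
  rewrite col_range_diag_l hrange /setI /= col_range_diag_l col_range_diag_r.
  set x1 := rowsub _ (rowsub _ x); set x2 := rowsub _ (rowsub _ x).
  have -> : x1 = rowsub enum_val x.
    apply/colP => i; rewrite !mxE; congr (x _ _); apply/val_inj.
    by rewrite /= enum_val_idx_range //; lia.
  have -> // : x2 = rowsub enum_val x.
  apply/colP => i; rewrite !mxE; congr (x _ _); apply/val_inj.
  by rewrite /= enum_val_idx_range.
have SC_psd Y : (psd_congr U `&` @SC R n) Y <-> psd_congr U Y /\ Y *m ones n = 0.
  split=> [[YU [_ Y1]]//|[YU Y1]]; split=> //; split=> //.
  by have /psd_congr_range[[]] := YU.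
split; apply/seteqP; split=> Y.
- move=> [/(face_clique _ hD hk1 hS1 hB1)[hY Y1 YU1]].
  move=> /(face_clique _ hD hk2 hS2 hB2)[_ _ YU2].
  by apply/SC_psd; split=> //; apply/psd_congr_range; split=> // x; apply/rangeU.
- move=> /SC_psd[/psd_congr_range[hY YU] Y1].
  by split; [apply/(face_clique _ hD hk1 hS1 hB1)|apply/(face_clique _ hD hk2 hS2 hB2)];
    split=> // x; have /rangeU[] := YU x.
- by move=> /SC_psd /(psd_congr_ortho_compl _ hV).
- by move=> /(psd_congr_ortho_compl _ hV) /SC_psd.
Qed.
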